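(* Suppose that the matrix $Q$ is indefinite. For $\alpha_e\ge 0$, denote by $\mu_{\mathrm{EIG}}(\alpha_e)$ the optimal objective function value of $$\min_{x\in\mathcal X}\ x^TQ_{\alpha_e}x+q_{\alpha_e}^Tx+k_{\alpha_e},\qquad Q_{\alpha_e}=Q+\alpha_eI_n,\quad q_{\alpha_e}=q-\alpha_e(l+u),\quad k_{\alpha_e}=\alpha_e\,l^Tu,$$ and denote by $\mu_{\mathrm{SDP\_EIG}}$ the optimal objective function value of $$\min_{x\in\mathcal X,\;X\in\mathbb S^n}\ \langle Q,X\rangle+q^Tx\quad\text{s.t.}\quad X-xx^T\succcurlyeq0,\quad \langle I_n,X\rangle-(l+u)^Tx+l^Tu\le 0.$$ Then the following hold: (i) If $\alpha_e\ge-\lambda_{\min}(Q)$, then $\mu_{\mathrm{EIG}}(\alpha_e)\le\mu_{\mathrm{SDP\_EIG}}$. (ii) If $\alpha_e=-\lambda_{\min}(Q)$, then $\mu_{\mathrm{EIG}}(\alpha_e)=\mu_{\mathrm{SDP\_EIG}}$.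
   Context: $Q\in\mathbb R^{n\times n}$ is symmetric, $q\in\mathbb R^n$, and $\mathcal X=\{x\in\mathbb R^n: Ax=b,\ Cx\le d,\ l\le x\le u\}$ with $A\in\mathbb R^{m\times n}$, $b\in\mathbb R^m$, $C\in\mathbb R^{p\times n}$, $d\in\mathbb R^p$, and finite bounds $-\infty<l_i<u_i<\infty$ for all $i$. $\mathbb S^n$ is the set of real symmetric $n\times n$ matrices, $\langle M,P\rangle=\sum_{i,j}M_{ij}P_{ij}$, $M\succcurlyeq0$ means positive semidefinite, $I_n$ is the identity, and $\lambda_{\min}(M)$ is the smallest eigenvalue of $M\in\mathbb S^n$. *)

(* Defs.v *)
From HB Require Import structures.
From mathcomp Require Import all_boot all_order all_algebra.
From mathcomp Require Import all_classical all_reals all_analysis.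

Set Implicit Arguments.
Unset Strict Implicit.
Unset Printing Implicit Defensive.

Import Order.TTheory GRing.Theory Num.Theory.

Local Open Scope classical_set_scope.
Local Open Scope ring_scope.

Section Matrices.
Context {R : realType} {n : nat}.
Implicit Types (x y : 'cV[R]_n) (M P : 'M[R]_n).

Definition dotv x y : R := (x^T *m y) 0 0.

Definition qform M x : R := (x^T *m M *m x) 0 0.

Definition mxinner M P : R := \sum_i \sum_j M i j * P i j.

(* Symmetry is not part of [psdmx]; it is only applied to symmetric matrices. *)
Definition psdmx M : Prop := forall x, 0 <= qform M x.

Definition indefmx M : Prop :=
  (exists x, qform M x < 0) /\ (exists y, 0 < qform M y).

(* A real symmetric matrix of positive order has a finite nonempty real
   spectrum, so this infimum is its smallest eigenvalue.  [eigenvalue] refers to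
   row eigenvectors, which is immaterial for symmetric matrices. *)
Definition lambda_min M : R := inf [set a : R | eigenvalue M a].

End Matrices.

(* Optimal value of minimizing [f] over [F], with value +oo when [F] is empty. *)
Definition optval {R : realType} {T : Type} (f : T -> R) (F : set T) : \bar R :=
  ereal_inf [set (f x)%:E | x in F].

Section Problems.
Context {R : realType} {n m p : nat}.
Variables (Q : 'M[R]_n) (q : 'cV[R]_n).
Variables (A : 'M[R]_(m, n)) (b : 'cV[R]_m).
Variables (C : 'M[R]_(p, n)) (d : 'cV[R]_p).
Variables (l u : 'cV[R]_n).

Definition feasible : set 'cV[R]_n :=
  [set x | [/\ A *m x = b,
               forall i, (C *m x) i 0 <= d i 0
             & forall i, l i 0 <= x i 0 <= u i 0]].

Definition Q_eig (alpha : R) : 'M[R]_n := Q + alpha%:M.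
Definition q_eig (alpha : R) : 'cV[R]_n := q - alpha *: (l + u).
Definition k_eig (alpha : R) : R := alpha * dotv l u.

Definition mu_eig (alpha : R) : \bar R :=
  optval (fun x => qform (Q_eig alpha) x + dotv (q_eig alpha) x + k_eig alpha)
         feasible.

Definition sdp_eig_feasible : set ('cV[R]_n * 'M[R]_n) :=
  [set z | let: (x, X) := z in
     [/\ feasible x,
         X \is symmetricmx,
         psdmx (X - x *m x^T)
       & mxinner 1%:M X - dotv (l + u) x + dotv l u <= 0]].

Definition mu_sdp_eig : \bar R :=
  optval (fun z : 'cV[R]_n * 'M[R]_n => mxinner Q z.2 + dotv q z.1)
         sdp_eig_feasible.

End Problems.

(* Main.v *)
Require Import Defs.
From mathcomp Require Import all_boot all_order all_algebra.
From mathcomp Require Import all_classical all_reals all_analysis.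
From mathcomp Require Import ring lra.

(** Write s(x) = x^T x - (l + u)^T x + l^T u.  The convexified objective at x is
x^T Q x + q^T x + alpha * s(x), and s(x) = - sum_i (x_i - l_i)(u_i - x_i) is
nonpositive on the box.

For the inequality, take (x, X) feasible for the semidefinite relaxation and
put D = X - x x^T, which is positive semidefinite.  When
alpha >= - lambda_min(Q), the matrix Q + alpha I is positive semidefinite too,
so <Q + alpha I, D> >= 0, i.e. <Q, D> >= - alpha tr D; and the trace constraint
reads tr D <= - s(x).  Hence <Q, X> + q^T x >= x^T Q x + q^T x + alpha s(x):
the point x alone is at least as good ([eig_le_sdp_objective]).

For equality at alpha = - lambda_min(Q), take x feasible and a unit eigenvector
v for lambda_min(Q).  The point X = x x^T - s(x) v v^T saturates the trace
constraint, and its objective value is x^T Q x + q^T x - s(x) lambda_min(Q),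
exactly the convexified one.

Two facts of linear algebra carry this, and both come from the Cauchy-Schwarz
inequality for a semidefinite form ([psd_cauchy_schwarz]), without
diagonalization.  The inner product of two semidefinite matrices is nonnegative
because one of them can be written as a sum of rank-one matrices by peeling off
its columns ([mxinner_psd_ge0]).  The smallest eigenvalue a of Q exists and
Q - a I is semidefinite ([symmetric_extremal_eigenvector],
[lambda_min_extremal]): the largest a with Q - a I semidefinite makes Q - a I
singular, since an invertible semidefinite matrix is coercive and would leave
room for a larger a. *)

Set Implicit Arguments.
Unset Strict Implicit.
Unset Printing Implicit Defensive.

Import Order.TTheory GRing.Theory Num.Theory.

Local Open Scope ring_scope.

(** * Dot products and quadratic forms *)

Section DotProduct.
Context {R : realType} {n : nat}.
Implicit Types (x y z : 'cV[R]_n) (M P : 'M[R]_n) (a : R).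

Lemma dotvE x y : dotv x y = \sum_i x i 0 * y i 0.
Proof. by rewrite /dotv mxE; apply: eq_bigr => i _; rewrite mxE. Qed.

Lemma dotvC x y : dotv x y = dotv y x.
Proof. by rewrite !dotvE; apply: eq_bigr => i _; rewrite mulrC. Qed.

Lemma dotvDr x y z : dotv x (y + z) = dotv x y + dotv x z.
Proof. by rewrite /dotv mulmxDr mxE. Qed.

Lemma dotvZr a x y : dotv x (a *: y) = a * dotv x y.
Proof. by rewrite /dotv -scalemxAr mxE. Qed.

Lemma dotvNr x y : dotv x (- y) = - dotv x y.
Proof. by rewrite -scaleN1r dotvZr mulN1r. Qed.

Lemma dotvDl x y z : dotv (x + y) z = dotv x z + dotv y z.
Proof. by rewrite !(dotvC _ z) dotvDr. Qed.

Lemma dotvZl a x y : dotv (a *: x) y = a * dotv x y.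
Proof. by rewrite !(dotvC _ y) dotvZr. Qed.

Lemma dotvNl x y : dotv (- x) y = - dotv x y.
Proof. by rewrite !(dotvC _ y) dotvNr. Qed.

Lemma dotv_mulmx x M y : dotv x (M *m y) = dotv (M^T *m x) y.
Proof. by rewrite /dotv trmx_mul trmxK mulmxA. Qed.

Lemma dotv_ge0 x : 0 <= dotv x x.
Proof. by rewrite dotvE; apply: sumr_ge0 => i _; rewrite -expr2 sqr_ge0. Qed.

Lemma dotv_gt0 x : x != 0 -> 0 < dotv x x.
Proof.
move=> x0; rewrite lt_neqAle dotv_ge0 andbT eq_sym; apply: contra_neq x0.
rewrite dotvE => /eqP; rewrite psumr_eq0 => [/allP x0|i _]; last first.
  by rewrite -expr2 sqr_ge0.
apply/colP => i; rewrite mxE; apply/eqP.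
by have := x0 i (mem_index_enum i); rewrite mulf_eq0 orbb.
Qed.

Lemma dotv_unit_scale x : x != 0 -> exists a, dotv (a *: x) (a *: x) = 1.
Proof.
move=> /dotv_gt0 x0; exists (Num.sqrt (dotv x x))^-1.
have s0 : Num.sqrt (dotv x x) != 0 by rewrite gt_eqF ?sqrtr_gt0.
rewrite dotvZl dotvZr -{3}(sqr_sqrtr (ltW x0)); by field.
Qed.

Lemma qformE M x : qform M x = dotv x (M *m x).
Proof. by rewrite /qform /dotv mulmxA. Qed.

Lemma qformD M P x : qform (M + P) x = qform M x + qform P x.
Proof. by rewrite !qformE mulmxDl dotvDr. Qed.

Lemma qform_scalar a x : qform a%:M x = a * dotv x x.
Proof. by rewrite qformE mul_scalar_mx dotvZr. Qed.

Lemma qform_rank1 y x : qform (y *m y^T) x = dotv x y ^+ 2.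
Proof.
by rewrite /qform mulmxA -mulmxA mxE big_ord1 expr2 -/(dotv x y) -/(dotv y x)
  (dotvC y).
Qed.

(** Each product |x_i x_j| is at most x^T x, so the sum of the absolute values of
the entries of M bounds the form.  This crude
constant serves where only the existence of a bound matters. *)
Lemma qform_le M x : `|qform M x| <= (\sum_i \sum_j `|M i j|) * dotv x x.
Proof.
have coord_le i j : `|x i 0| * `|x j 0| <= dotv x x.
  have le_sq k : `|x k 0| ^+ 2 <= dotv x x.
    rewrite real_normK ?num_real// dotvE (bigD1 k)//= -expr2 lerDl.
    by apply: sumr_ge0 => h _; rewrite -expr2 sqr_ge0.
  have := le_sq i; have := le_sq j.
  have := sqr_ge0 (`|x i 0| - `|x j 0|); nra.
rewrite qformE dotvE (le_trans (ler_norm_sum _ _ _))// mulr_suml.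
apply: ler_sum => i _; rewrite mxE mulr_sumr (le_trans (ler_norm_sum _ _ _))//.
rewrite mulr_suml; apply: ler_sum => j _.
rewrite mulrCA normrM ler_wpM2l// normrM; exact: coord_le.
Qed.

(** The quadratic t |-> qform M (x + t *: y) is nonnegative, so its discriminant
is nonpositive. *)
Lemma psd_cauchy_schwarz M x y : M^T = M -> psdmx M ->
  dotv x (M *m y) ^+ 2 <= qform M x * qform M y.
Proof.
move=> Msym Mpsd; pose p := \poly_(i < 3)
  [:: qform M x; 2 * dotv x (M *m y); qform M y]`_i.
have : p`_1 ^+ 2 - 4 * p`_2 * p`_0 <= 0.
  rewrite deg_le2_poly_ge0 ?size_poly// => t.
  rewrite horner_poly !big_ord_recr big_ord0/=.
  have := Mpsd (x + t *: y).
  rewrite !qformE mulmxDr -scalemxAr !(dotvDl, dotvDr, dotvZl, dotvZr).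
  by rewrite [dotv y (M *m x)]dotv_mulmx Msym [dotv (M *m y) x]dotvC; nra.
by rewrite !coef_poly /=; lra.
Qed.

(** Cauchy-Schwarz for x and M^-1 x gives (x^T x)^2 <= (x^T M x)(x^T M^-1 x), and
x^T M^-1 x is at most a constant times x^T x. *)
Lemma psd_unitmx_coercive M : M^T = M -> psdmx M -> M \in unitmx ->
  exists2 e, 0 < e & forall x, e * dotv x x <= qform M x.
Proof.
move=> Msym Mpsd Munit; pose N := invmx M; pose K := 1 + \sum_i \sum_j `|N i j|.
have K0 : 0 < K.
  by rewrite ltr_pwDl//; do 2![apply: sumr_ge0 => ? _].
exists K^-1; first by rewrite invr_gt0.
move=> x; rewrite mulrC ler_pdivrMr//.
have CS := psd_cauchy_schwarz x (N *m x) Msym Mpsd.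
rewrite (qformE M (N *m x)) !mulmxA mulmxV// mul1mx (dotvC (N *m x)) -qformE in CS.
have NK : qform N x <= K * dotv x x.
  rewrite (le_trans (ler_norm _))// (le_trans (qform_le _ _))//.
  by rewrite ler_wpM2r ?dotv_ge0// lerDr.
have := Mpsd x; have := dotv_ge0 x; rewrite le_eqVlt => /predU1P[<-|x0 qx0].
  by move=> ?; rewrite mulr_ge0// ltW.
rewrite -(ler_pM2r x0) -expr2 (le_trans CS)// -mulrA ler_wpM2l//.
Qed.

End DotProduct.

(** * Inner product of positive semidefinite matrices *)

Section PsdInnerProduct.
Context {R : realType} {n : nat}.
Implicit Types (x y : 'cV[R]_n) (M D P : 'M[R]_n) (a : R).

Lemma mxinnerDr M D P : mxinner M (D + P) = mxinner M D + mxinner M P.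
Proof.
rewrite /mxinner -big_split; apply: eq_bigr => i _.
by rewrite -big_split; apply: eq_bigr => j _; rewrite mxE mulrDr.
Qed.

Lemma mxinnerZr a M D : mxinner M (a *: D) = a * mxinner M D.
Proof.
rewrite /mxinner mulr_sumr; apply: eq_bigr => i _.
by rewrite mulr_sumr; apply: eq_bigr => j _; rewrite mxE mulrCA.
Qed.

Lemma mxinnerDl M D P : mxinner (M + D) P = mxinner M P + mxinner D P.
Proof.
rewrite /mxinner -big_split; apply: eq_bigr => i _.
by rewrite -big_split; apply: eq_bigr => j _; rewrite mxE mulrDl.
Qed.

Lemma mxinner_scalar a D : mxinner a%:M D = a * mxinner 1%:M D.
Proof.
rewrite /mxinner mulr_sumr; apply: eq_bigr => i _.
rewrite mulr_sumr; apply: eq_bigr => j _.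
by rewrite !mxE mulrA mulr_natr.
Qed.

Lemma mxinner_rank1 M x : mxinner M (x *m x^T) = qform M x.
Proof.
rewrite qformE dotvE; apply: eq_bigr => i _; rewrite mxE mulr_sumr.
by apply: eq_bigr => j _; rewrite !mxE big_ord1 mxE; ring.
Qed.

Lemma trmx_rank1 x : (x *m x^T)^T = x *m x^T.
Proof. by rewrite trmx_mul trmxK. Qed.

Lemma dotv_delta M i j : dotv (delta_mx i 0) (M *m delta_mx j 0) = M i j.
Proof.
by rewrite -colE dotvE (bigD1 i)//= big1 => [|k /negPf ki];
  rewrite !mxE ?eqxx ?ki ?mul1r ?mul0r ?addr0.
Qed.

Lemma psd_entry_sqr_le D i j : D^T = D -> psdmx D ->
  D i j ^+ 2 <= D i i * D j j.
Proof.
move=> Dsym Dpsd.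
have := psd_cauchy_schwarz (delta_mx i 0) (delta_mx j 0) Dsym Dpsd.
by rewrite !qformE !dotv_delta.
Qed.

(** Cauchy-Schwarz against the i-th basis vector: (x^T D e_i)^2 is at most
(x^T D x) D_ii.  The difference is the Schur complement of D_ii, padded with a
zero row and column. *)
Lemma psd_schur_peel D i : D^T = D -> psdmx D -> D i i != 0 ->
  psdmx (D - (D i i)^-1 *: (col i D *m (col i D)^T)).
Proof.
move=> Dsym Dpsd Dii x; rewrite -scaleNr qformD.
have -> : forall a P, qform (a *: P) x = a * qform P x.
  by move=> a P; rewrite !qformE -scalemxAl dotvZr.
rewrite qform_rank1 mulNr subr_ge0.
have Dii0 : 0 < D i i.
  by rewrite lt_neqAle eq_sym Dii -dotv_delta -qformE Dpsd.
rewrite mulrC ler_pdivrMr// colE.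
have := psd_cauchy_schwarz x (delta_mx i 0) Dsym Dpsd.
by rewrite [qform D (delta_mx _ _)]qformE dotv_delta.
Qed.

(** Peeling column i off D splits <M, D> into <M, D'> and a nonnegative multiple
of (D e_i)^T M (D e_i).  Peeling kills the i-th diagonal entry and revives
none: a zero diagonal entry of a semidefinite matrix has a zero row.  So the
number of nonzero diagonal entries strictly decreases, and once it is 0 the
matrix is 0. *)
Lemma mxinner_psd_ge0 M D : D^T = D -> psdmx M -> psdmx D -> 0 <= mxinner M D.
Proof.
move=> + Mpsd; have [k] := ubnP #|[pred j | D j j != 0]|.
elim: k D => // k IH D leDk Dsym Dpsd.
case: (pickP [pred j | D j j != 0]) => [i /= Dii|D0]; last first.
  rewrite /mxinner big1// => i _; rewrite big1// => j _.
  have := psd_entry_sqr_le i j Dsym Dpsd.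
  have /negbFE/eqP -> := D0 i.
  by rewrite mul0r real_exprn_even_le0 ?num_real//= => /eqP ->; rewrite mulr0.
pose D' := D - (D i i)^-1 *: (col i D *m (col i D)^T).
have D'E j : D' j j = D j j - (D i i)^-1 * D j i ^+ 2.
  by rewrite !mxE big_ord1 !mxE.
have -> : D = D' + (D i i)^-1 *: (col i D *m (col i D)^T) by rewrite subrK.
rewrite mxinnerDr mxinnerZr mxinner_rank1 addr_ge0//.
  apply: IH; last exact: psd_schur_peel.
    rewrite (leq_trans _ (ltnSE leDk : leq _ _))//.
    apply/proper_card/properP; split.
      apply/fintype.subsetP => j; rewrite !inE; apply: contra_neq => Djj.
      have := psd_entry_sqr_le j i Dsym Dpsd.
      rewrite D'E Djj mul0r real_exprn_even_le0 ?num_real//= => /eqP ->.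
      by rewrite expr0n mulr0 subrr.
    by exists i; rewrite !inE ?Dii// D'E negbK expr2 mulKf// subrr.
  by rewrite /D' linearB/= linearZ/= trmx_rank1 Dsym.
rewrite mulr_ge0// invr_ge0 -dotv_delta -qformE; exact: Dpsd.
Qed.

End PsdInnerProduct.

(** * The smallest eigenvalue of a symmetric matrix *)

Section MinimalEigenvalue.
Context {R : realType} {n : nat}.
Implicit Types (x v : 'cV[R]_n) (Q : 'M[R]_n).

(** The scalar a is the supremum of the c such that Q - c I is semidefinite.
That set is closed, so Q - a I is semidefinite; were it invertible, it would be
coercive and a could be increased.  A nonzero kernel vector is the eigenvector.
The nonzero x, which forces a positive order, bounds the set above. *)
Lemma symmetric_extremal_eigenvector Q x : Q^T = Q -> x != 0 ->
  exists a v, [/\ psdmx (Q - a%:M), v != 0 & Q *m v = a *: v].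
Proof.
move=> Qsym x0; pose S : set R := fun c => psdmx (Q - c%:M).
have qformS c y : qform (Q - c%:M) y = qform Q y - c * dotv y y.
  by rewrite -(rmorphN (@scalar_mx R n)) qformD qform_scalar mulNr.
have S0 : (S !=set0)%classic.
  exists (- \sum_i \sum_j `|Q i j|) => y; rewrite qformS mulNr opprK.
  by have := qform_le Q y; rewrite ler_norml => /andP[]; lra.
have Sub : has_ubound S.
  exists (qform Q x / dotv x x) => c /(_ x).
  by rewrite qformS ler_pdivlMr ?dotv_gt0// subr_ge0.
pose a := sup S.
have Sa : S a.
  move=> y; rewrite qformS subr_ge0.
  have [->|y0] := eqVneq y 0; first by rewrite qformE mulmx0 /dotv mulmx0 mxE mulr0.
  rewrite -ler_pdivlMr ?dotv_gt0//; apply: ge_sup => // c /(_ y).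
  by rewrite qformS ler_pdivlMr ?dotv_gt0// subr_ge0.
have Masym : (Q - a%:M)^T = Q - a%:M by rewrite linearB/= tr_scalar_mx Qsym.
exists a; have [/(psd_unitmx_coercive Masym Sa) [e e0 He]|] :=
  boolP (Q - a%:M \in unitmx).
  suff /(ub_le_sup Sub) : S (a + e) by rewrite gerDl leNgt e0.
  by move=> y; have := He y; rewrite !qformS; lra.
rewrite -row_free_unit -kermx_eq0 => /rowV0Pn[w /sub_kermxP wM w0].
exists w^T; split => //; first by rewrite trmx_eq0.
apply/eqP; rewrite -subr_eq0 -mul_scalar_mx -mulmxBl -Masym -trmx_mul wM.
by rewrite trmx0.
Qed.

(** If w is an eigenvector for c, the form of Q - a I at w is (c - a) w^T w, so a
is below every eigenvalue; it is one itself. *)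
Lemma lambda_min_extremal Q a v : Q^T = Q -> psdmx (Q - a%:M) ->
  v != 0 -> Q *m v = a *: v -> lambda_min Q = a.
Proof.
move=> Qsym Qa v0 Qv.
have lba : lbound [set c : R | eigenvalue Q c]%classic a.
  move=> c /= /eigenvalueP[w wQ w0].
  have wT0 : w^T != 0 by rewrite trmx_eq0.
  have QwT : Q *m w^T = c *: w^T by rewrite -Qsym -trmx_mul wQ linearZ.
  have := Qa w^T; rewrite qformE mulmxBl QwT mul_scalar_mx -scalerBl dotvZr.
  by rewrite pmulr_lge0 ?dotv_gt0// subr_ge0.
have eiga : [set c : R | eigenvalue Q c]%classic a.
  apply/eigenvalueP; exists v^T; last by rewrite trmx_eq0.
  by rewrite -[in LHS]Qsym -trmx_mul Qv linearZ.
apply/eqP; rewrite eq_le /lambda_min; apply/andP; split.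
  by apply: ge_inf => //; exists a.
by apply: lb_le_inf => //; exists a.
Qed.

End MinimalEigenvalue.

(** * Comparison of the two relaxations *)

Lemma optval_le {R : realType} {S T : Type} (f : S -> R) (F : set S)
    (g : T -> R) (G : set T) :
  (forall z, G z -> exists2 x, F x & f x <= g z) ->
  (optval f F <= optval g G)%E.
Proof.
move=> FG; apply: le_ereal_inf_tmp => _ [z Gz <-].
have [x Fx fg] := FG z Gz.
apply: (@le_trans _ _ (f x)%:E); last by rewrite lee_fin.
by apply: ereal_inf_lbound; exists x.
Qed.

Section Relaxations.
Context {R : realType} {n : nat}.
Implicit Types (x v : 'cV[R]_n) (Q X : 'M[R]_n).

Lemma eig_objectiveE Q q l u alpha x :
  qform (Q_eig Q alpha) x + dotv (q_eig q l u alpha) x + k_eig l u alpha =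
  qform Q x + dotv q x + alpha * (dotv x x - dotv (l + u) x + dotv l u).
Proof.
rewrite qformD qform_scalar /k_eig /q_eig dotvDl dotvNl dotvZl; ring.
Qed.

(** The quadratic constraint is the sum of the products of the slacks of the
bounds: this is where its sign on the box comes from. *)
Lemma box_slackE l u x :
  dotv x x - dotv (l + u) x + dotv l u = - \sum_i (x i 0 - l i 0) * (u i 0 - x i 0).
Proof.
rewrite !dotvE -sumrB -big_split/= -sumrN; apply: eq_bigr => i _.
by rewrite mxE; ring.
Qed.

(** With D = X - x x^T, the claim is <Q, D> >= alpha s(x), s being the trace
constraint at X = x x^T.  It is the sum of <Q + alpha I, D> >= 0 and alpha
times the trace constraint tr D + s(x) <= 0. *)
Lemma eig_le_sdp_objective Q q l u alpha x X : X^T = X ->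
  0 <= alpha -> psdmx (Q_eig Q alpha) -> psdmx (X - x *m x^T) ->
  mxinner 1%:M X - dotv (l + u) x + dotv l u <= 0 ->
  qform (Q_eig Q alpha) x + dotv (q_eig q l u alpha) x + k_eig l u alpha <=
  mxinner Q X + dotv q x.
Proof.
move=> Xsym alpha0 Qpsd Dpsd trX; rewrite eig_objectiveE.
have Dsym : (X - x *m x^T)^T = X - x *m x^T.
  by rewrite linearB/= trmx_rank1 Xsym.
have := mxinner_psd_ge0 Dsym Qpsd Dpsd.
rewrite -[X in mxinner Q X](subrK (x *m x^T)) mxinnerDl mxinner_scalar.
move: trX; rewrite -[X in mxinner 1%:M X](subrK (x *m x^T)).
rewrite !mxinnerDr !mxinner_rank1 qform_scalar mul1r; nra.
Qed.

End Relaxations.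

Theorem proposition2 (R : realType) (n m p : nat)
    (Q : 'M[R]_n) (q : 'cV[R]_n)
    (A : 'M[R]_(m, n)) (b : 'cV[R]_m)
    (C : 'M[R]_(p, n)) (d : 'cV[R]_p)
    (l u : 'cV[R]_n)
    (Qsym : Q \is symmetricmx)
    (lu : forall i, l i 0 < u i 0)
    (Qindef : indefmx Q)
    (alpha_e : R) (alpha_ge0 : 0 <= alpha_e) :
  (- lambda_min Q <= alpha_e ->
     (mu_eig Q q A b C d l u alpha_e <= mu_sdp_eig Q q A b C d l u)%E)
  /\
  (alpha_e = - lambda_min Q ->
     mu_eig Q q A b C d l u alpha_e = mu_sdp_eig Q q A b C d l u).
Proof.
have symE (M : 'M[R]_n) : (M \is symmetricmx) = (M^T == M).
  by rewrite is_hermitianmxE expr0 scale1r map_mx_id// eq_sym.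
move: Qsym; rewrite symE => /eqP Qsym.
have [[y Qy] _] := Qindef.
have y0 : y != 0.
  by apply: contraTneq Qy => ->; rewrite /qform mulmx0 mxE ltxx.
have [a [w [Qa w0 Qw]]] := symmetric_extremal_eigenvector Qsym y0.
rewrite (lambda_min_extremal Qsym Qa w0 Qw).
have le_mu : - a <= alpha_e ->
    (mu_eig Q q A b C d l u alpha_e <= mu_sdp_eig Q q A b C d l u)%E.
  move=> a_alpha; apply: optval_le => -[x X] /= [Fx XS Xx trX].
  exists x => //; apply: eig_le_sdp_objective => //.
    by apply/eqP; rewrite -symE.
  move=> z; have -> : Q_eig Q alpha_e = (Q - a%:M) + (a + alpha_e)%:M.
    by rewrite raddfD/= addrA subrK.
  by rewrite qformD qform_scalar addr_ge0// mulr_ge0 ?dotv_ge0//; lra.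
split=> // alphaE; apply/eqP; rewrite eq_le le_mu ?alphaE ?lexx//=.
apply: optval_le => x Fx; have [_ _ xb] := Fx.
have [s v1] := dotv_unit_scale w0; pose v := s *: w.
pose t := \sum_i (x i 0 - l i 0) * (u i 0 - x i 0).
have t0 : 0 <= t.
  by apply: sumr_ge0 => i _; have /andP[? ?] := xb i; rewrite mulr_ge0 ?subr_ge0.
have slackE : dotv x x - dotv (l + u) x + dotv l u = - t := box_slackE l u x.
have Qv : qform Q v = a.
  by rewrite qformE -scalemxAr Qw scalerA mulrC -scalerA dotvZr v1 mulr1.
(* Weight t on v *m v^T is exactly what the trace constraint allows. *)
exists (x, x *m x^T + t *: (v *m v^T)) => /=.
  split => //.
  - by rewrite symE linearD/= linearZ/= !trmx_rank1.
  - rewrite addrAC subrr add0r => z.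
    by rewrite qformE -scalemxAl dotvZr -qformE qform_rank1 mulr_ge0 ?sqr_ge0.
  - by rewrite mxinnerDr mxinnerZr !mxinner_rank1 !qform_scalar v1; lra.
by rewrite eig_objectiveE mxinnerDr mxinnerZr !mxinner_rank1 Qv slackE; nra.
Qed.
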